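(* Let $S=(O,P,I)$ be a formal context with $O$ and $P$ finite, and let $O_{S_1},O_{S_2}\subseteq O$ satisfy $O_{S_1}\cup O_{S_2}=O$ and $O_{S_1}\cap O_{S_2}=\emptyset$. For $k=1,2$ let $S_k=(O_{S_k},P,I_{S_k})$ with $I_{S_k}=I\cap(O_{S_k}\times P)$. Then for every set of attributes $Y\subseteq P$, with $\mathcal{F}^{Y}_{S_1}$, $\mathcal{F}^{Y}_{S_2}$ and $\mathcal{F}^{Y}_{S}$ denoting the closures of $Y$ with respect to $S_1$, $S_2$ and $S$ respectively, $$\mathcal{F}^{Y}_{S}=\mathcal{F}^{Y}_{S_1}\cap\mathcal{F}^{Y}_{S_2}.$$
   Context: A formal context is a triple $(O,P,I)$ where $O$ is a set of objects, $P$ a set of attributes and $I\subseteq O\times P$ a binary relation; $(t,p)\in I$ means that object $t$ has attribute $p$. For a formal context $T=(O_T,P,I_T)$ the derivation operators are: for $X\subseteq O_T$, $X'_T=\{p\in P \mid \forall t\in X: (t,p)\in I_T\}$; for $Y\subseteq P$, $Y'_T=\{t\in O_T\mid \forall p\in Y: (t,p)\in I_T\}$. By this convention, the derivation of the empty object set is all of $P$. The closure of an attribute set $Y\subseteq P$ with respect to $T$ is $\mathcal{F}^{Y}_{T}=Y''_T=(Y'_T)'_T\subseteq P$. Both partitions share the same attribute set $P$; only the objects are divided. *)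

(* Defs.v *)
From mathcomp Require Import all_boot.

Set Implicit Arguments.
Unset Strict Implicit.
Unset Printing Implicit Defensive.

(* The finite sets O and P are subsets of ambient finite types U and M, so that
   contexts on different object sets, or on an empty one, live in one type. *)
Record formal_context (U M : finType) := FormalContext {
  objects : {set U};
  attributes : {set M};
  incidence : {set U * M};
  incidence_sub : incidence \subset setX objects attributes
}.

Section Derivation.

Variables (U M : finType) (T : formal_context U M).

(* X'_T, meant for X \subset objects T. *)
Definition common_attributes (X : {set U}) : {set M} :=
  [set p in attributes T | [forall t in X, (t, p) \in incidence T]].

(* Y'_T, meant for Y \subset attributes T. *)
Definition common_objects (Y : {set M}) : {set U} :=
  [set t in objects T | [forall p in Y, (t, p) \in incidence T]].

Definition attr_closure (Y : {set M}) : {set M} :=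
  common_attributes (common_objects Y).

(* (O', P, I :&: (O' x P)), meant for O' \subset objects T. *)
Definition subcontext (O' : {set U}) : formal_context U M :=
  FormalContext (subsetIr (incidence T) (setX O' (attributes T))).

End Derivation.

(* Main.v *)
(** The objects having all attributes of Y in a subcontext are those of the
    full context that lie in the subcontext, so the derivation of Y in S is the
    union of its derivations in the two parts; deriving back turns this union
    into the intersection of the closures. *)
Require Import Defs.
From mathcomp Require Import all_boot.

(** A universal condition over a union is the conjunction of those over its parts; an empty part
    yields all attributes, neutral for the intersection. *)
Lemma common_attributesU (U M : finType) (T : formal_context U M)
    (X1 X2 : {set U}) :
  common_attributes T (X1 :|: X2) =
  common_attributes T X1 :&: common_attributes T X2.
Proof.
apply/setP => p; rewrite !inE; case: (p \in attributes T) => //=.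
apply/forall_inP/andP => [pX | [/forall_inP pX1 /forall_inP pX2] t].
  by split; apply/forall_inP => t tX; apply: pX; rewrite inE tX ?orbT.
by rewrite inE => /orP[/pX1 | /pX2].
Qed.

(** Restriction removes only pairs whose object is outside [O'], and [X] has none. *)
Lemma common_attributes_subcontext (U M : finType) (T : formal_context U M)
    (O' X : {set U}) :
  X \subset O' ->
  common_attributes (subcontext T O') X = common_attributes T X.
Proof.
move=> /subsetP sXO; apply/setP => p; rewrite !inE /=.
case pT: (p \in attributes T) => //=.
by apply: eq_forallb_in => t /sXO tO; rewrite !inE /= tO pT !andbT.
Qed.

Lemma common_objects_subcontext (U M : finType) (T : formal_context U M)
    (O' : {set U}) (Y : {set M}) :
  O' \subset objects T -> Y \subset attributes T ->
  common_objects (subcontext T O') Y = O' :&: common_objects T Y.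
Proof.
move=> /subsetP sOT /subsetP sYT; apply/setP => t; rewrite !inE /=.
case tO: (t \in O') => //=; rewrite (sOT _ tO) /=.
by apply: eq_forallb_in => p /sYT pT; rewrite !inE /= tO pT !andbT.
Qed.

(** Expresses closures in different subcontexts through the derivations of the single context [T],
    where they can be combined. *)
Lemma attr_closure_subcontext (U M : finType) (T : formal_context U M)
    (O' : {set U}) (Y : {set M}) :
  O' \subset objects T -> Y \subset attributes T ->
  attr_closure (subcontext T O') Y =
  common_attributes T (O' :&: common_objects T Y).
Proof.
move=> sOT sYT; rewrite /attr_closure common_objects_subcontext //.
by rewrite common_attributes_subcontext ?subsetIl.
Qed.

Theorem theorem1 (U M : finType) (S : formal_context U M) (O1 O2 : {set U})
    (sO1 : O1 \subset objects S) (sO2 : O2 \subset objects S)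
    (O12U : O1 :|: O2 = objects S) (O12I : O1 :&: O2 = set0)
    (Y : {set M}) (sY : Y \subset attributes S) :
  attr_closure S Y =
  attr_closure (subcontext S O1) Y :&: attr_closure (subcontext S O2) Y.
Proof.
rewrite !attr_closure_subcontext // -common_attributesU -setIUl O12U.
(* Intersecting with [objects S] changes nothing, as [common_objects S Y] lies inside it. *)
rewrite (setIidPr _) //.
by apply/subsetP => t; rewrite inE => /andP[].
Qed.
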